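(* Let $P$ be a finite poset with labeling $\omega$ such that $P$ is $\omega$-consistent with rank function $\rho$, and suppose $|\rho(x)-\rho(y)|\le1$ for all maximal elements $x,y$ of $P$. Then $W(P,\omega;t)$ has unimodal coefficients.
   Context: $P$ has $p$ elements and $\omega:P\to\{1,\dots,p\}$ is a bijection. Write $x\prec y$ if $y$ covers $x$; $\omega$ induces $\epsilon(x,y)=1$ if $\omega(x)<\omega(y)$ and $-1$ otherwise on covering pairs. $P$ is $\omega$-consistent if for every $z\in P$ the sum $\sum\epsilon(x_{i-1},x_i)$ is the same over all maximal chains $x_0\prec\cdots\prec x_n$ of the principal ideal $\Lambda_z=\{w\le z\}$; this common value is $\rho(z)$. $W(P,\omega;t)=\sum_{\pi}t^{\mathrm{des}(\pi)}$, summing over permutations $\pi=\omega(x_1)\cdots\omega(x_p)$ with $x_1,\dots,x_p$ a linear extension of $P$, where $\mathrm{des}(\pi)=\#\{i:\pi_i>\pi_{i+1}\}$. *)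

(* Defs.v *)
From HB Require Import structures.
From mathcomp Require Import all_boot all_order all_algebra.
Set Implicit Arguments. Unset Strict Implicit. Unset Printing Implicit Defensive.
Import Order.TTheory GRing.Theory Num.Theory.

Section PosetDefs.
Variables (d : Order.disp_t) (T : finPOrderType d).

Definition max_chain (z : T) (s : seq T) : Prop :=
  [/\ sorted (fun a b => (a < b)%O) s,
      all (fun w => (w <= z)%O) s &
      forall w : T, (w <= z)%O -> w \notin s ->
        ~~ all (fun u => (w >=< u)%O) s].

Definition eps (omega : T -> nat) (x y : T) : int :=
  if omega x < omega y then 1%R else (-1)%R.

Definition chain_sum (omega : T -> nat) (s : seq T) : int :=
  \sum_(pr <- zip s (behead s)) eps omega pr.1 pr.2.

Definition maximal (x : T) : bool := [forall y : T, (x <= y)%O ==> (y == x)].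

(* linear extension x_1 ... x_p, as a #|T|-tuple listing every element once *)
Definition lin_ext (s : #|T|.-tuple T) : bool :=
  uniq s && [forall x : T, forall y : T, (x < y)%O ==> (index x s < index y s)].

End PosetDefs.

Definition des (s : seq nat) : nat := count (fun pr => pr.2 < pr.1) (zip s (behead s)).

Definition W d (T : finPOrderType d) (omega : T -> nat) : {poly int} :=
  (\sum_(s : #|T|.-tuple T | lin_ext s) 'X^(des (map omega s)))%R.

Definition unimodal (p : {poly int}) : Prop :=
  exists m : nat,
    (forall i j : nat, i <= j <= m -> (p`_i <= p`_j)%R) /\
    (forall i j : nat, m <= i <= j -> (p`_j <= p`_i)%R).

(* Main.v *)
Require Import Defs.
From HB Require Import structures.
From mathcomp Require Import all_boot all_order all_algebra.
From mathcomp Require Import zify ring.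
Import Order.TTheory GRing.Theory Num.Theory.

Set Implicit Arguments.
Unset Strict Implicit.
Unset Printing Implicit Defensive.

(** Write [rho = 2 c + q] with [q] in [{0, 1}]. Along a cover the parity
    [q] changes, and [sigma] is a (P, omega)-partition iff [z = sigma + c] is
    a (P, k)-partition, where the canonical labelling [k] puts all even elements
    before all odd ones. Sorting the values of [sigma], respectively of [z],
    counts the (P, omega)-partitions into [{0, ..., n}] in two ways as a sum over
    linear extensions; comparing them for all [n] shows that [des_omega] and
    [des_k - c(last letter)] are equidistributed on linear extensions.

    Since covers change the parity, the elements of a maximal run of equal parity
    in a linear extension form an antichain, so a linear extension is a
    concatenation of arbitrary permutations of antichains of alternating parity:
    [des_k] has a generating polynomial that is a sum of shifted products of
    Eulerian polynomials. All terms with a given parity of the last letter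
    have the same centre of symmetry, and each is a nonnegative combination of
    polynomials [X^i (1 + X)^N] with that centre. The hypothesis on maximal
    elements puts the two centres (one per parity of the last letter) at distance
    at most 1/2, and the sum of two such symmetric unimodal polynomials is
    unimodal. *)

(** * Symmetric unimodal sequences *)

(** Integer indices, with value 0 below 0, let reflections and negative shifts be applied without
    side conditions. *)
Definition icoef (p : {poly int}) (i : int) : int :=
  if i is Posz n then p`_n%R else 0%R.

(* [e], here and in [gam], is twice the centre of symmetry. *)
Definition symuni (e : int) (f : int -> int) : Prop :=
  (forall i, f (e - i)%R = f i) /\ (forall i, (i *+ 2 < e)%R -> (f i <= f (i + 1))%R).

(** Gamma-nonnegativity: the cone spanned by the [X^i (1 + X)^N] with a fixed centre. Closure under
    products, needed for products of Eulerian polynomials, is immediate in this form. *)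
Inductive gam : int -> {poly int} -> Prop :=
| gam0 e : gam e 0%R
| gamD e p q : gam e p -> gam e q -> gam e (p + q)%R
| gamB i N : gam (i.*2 + N)%N%:Z ('X^i * (1 + 'X) ^+ N)%R.

Lemma gam_eq e e' p q : gam e p -> e = e' -> p = q -> gam e' q.
Proof. by move=> H <- <-. Qed.

Lemma gam_sum (I : eqType) (r : seq I) (P : pred I) (F : I -> {poly int}) e :
  (forall i, i \in r -> P i -> gam e (F i)) -> gam e (\sum_(i <- r | P i) F i)%R.
Proof.
move=> H; rewrite big_seq_cond; apply: big_ind => [|p q|i /andP[]]; first exact: gam0.
- exact: gamD.
- exact: H.
Qed.

Lemma gamM e1 e2 p q : gam e1 p -> gam e2 q -> gam (e1 + e2)%R (p * q)%R.
Proof.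
move=> H1; elim: H1 e2 q => {e1 p} [e1 | e1 p1 p2 _ IH1 _ IH2 | i N] e2 q.
- by move=> _; rewrite mul0r; apply: gam0.
- by move=> H; rewrite mulrDl; apply: gamD; [apply: IH1 | apply: IH2].
elim=> {e2 q} [e2 | e2 q1 q2 _ IH1 _ IH2 | j M].
- by rewrite mulr0; apply: gam0.
- by rewrite mulrDr; apply: gamD.
apply: (gam_eq (gamB (i + j) (N + M))); first lia.
by rewrite !exprD; ring.
Qed.

Lemma gam1 : gam 0 1%R.
Proof. by apply: (gam_eq (gamB 0 0)); rewrite ?expr0 ?mulr1. Qed.

Lemma gamXn i : gam (i.*2)%:Z 'X^i%R.
Proof. by apply: (gam_eq (gamB i 0)); rewrite ?expr0 ?mulr1 ?addn0. Qed.

Lemma icoefD p q i : (icoef (p + q) i = icoef p i + icoef q i)%R.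
Proof. by case: i => n //=; rewrite ?coefD. Qed.

Lemma icoefXM p i : (icoef ('X * p) i = icoef p (i - 1))%R.
Proof.
by case: i => [[|n]|n]; rewrite {1}/icoef ?coefXM //= subn1.
Qed.

Lemma symuniX e p : symuni e (icoef p) -> symuni (e + 2)%R (icoef ('X * p))%R.
Proof.
move=> [S U]; split=> i; first by rewrite !icoefXM -S; congr icoef; lia.
move=> H; rewrite !icoefXM.
have -> : (i + 1 - 1 = (i - 1) + 1)%R by lia.
by apply: U; lia.
Qed.

Lemma symuni1X e p : symuni e (icoef p) -> symuni (e + 1)%R (icoef ((1 + 'X) * p))%R.
Proof.
move=> [S U]; split=> i.
  rewrite !mulrDl !mul1r !icoefD !icoefXM addrC.
  by congr (_ + _)%R; rewrite -S; congr icoef; lia.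
move=> H; rewrite !mulrDl !mul1r !icoefD !icoefXM addrK addrC lerD2r.
case: (ltrP (i *+ 2)%R e) => [lt_ie|le_ei].
  apply: le_trans (U _ lt_ie).
  by have := U (i - 1)%R; rewrite subrK; apply; lia.
(* Here [2 i = e], so [i - 1] and [i + 1] are mirror images. *)
by rewrite -S le_eqVlt; apply/orP; left; apply/eqP; congr icoef; lia.
Qed.

Lemma gam_symuni e p : gam e p -> symuni e (icoef p).
Proof.
elim=> {e p} [e | e p q _ [S1 U1] _ [S2 U2] | i N].
- have H0 i : icoef 0%R i = 0%R by case: i => n //=; rewrite coef0.
  by split=> i; rewrite !H0.
- by split=> i; rewrite !icoefD ?S1 ?S2 // => H; apply: lerD; [apply: U1|apply: U2].
elim: i => [|i IH].
  rewrite mul1r; elim: N => [|N IH].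
    have icoef1 i : icoef 1%R i = (i == 0%R)%:R%R.
      by case: i => n //=; rewrite coef1.
    rewrite expr0; split=> i; rewrite !icoef1; first by rewrite (_ : (_ - i == 0)%R = (i == 0%R)) //; lia.
    by move=> H; rewrite (_ : (i == 0%R) = false) ?ler0n //; lia.
  by rewrite exprS (_ : Posz _ = Posz (0.*2 + N) + 1)%R; [apply: symuni1X | lia].
rewrite exprS -mulrA (_ : Posz _ = Posz (i.*2 + N) + 2)%R; [exact: symuniX | lia].
Qed.

Lemma symuni_shift e f (c : int) :
  symuni e f -> symuni (e - c *+ 2)%R (fun i => f (i + c)%R).
Proof.
move=> [S U]; split=> i; first by rewrite -S; congr f; lia.
by move=> H; rewrite addrAC; apply: U; lia.
Qed.

Lemma symuni_dec e f i : symuni e f -> (e < i *+ 2 + 2)%R -> (f (i + 1) <= f i)%R.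
Proof.
move=> [S U] H; rewrite -(S i) -(S (i + 1)%R).
have -> : (e - i = (e - (i + 1)) + 1)%R by lia.
by apply: U; lia.
Qed.

(** The peak [m] is the floor of half of [max e0 e1]. Since the doubled centres differ by at most 1,
    both sequences still increase up to [m] and both decrease from [m] on. *)
Lemma unimodal_symuni2 (p : {poly int}) (f0 f1 : int -> int) (e0 e1 : int) :
  (`|e0 - e1| <= 1)%R -> symuni e0 f0 -> symuni e1 f1 ->
  (forall i : nat, p`_i = f0 i + f1 i)%R -> unimodal p.
Proof.
move=> close H0 H1 pE.
set e := Num.max e0 e1.
have [m m_lo m_hi] : exists2 m : int, (e < m *+ 2 + 2)%R & (m *+ 2 <= e)%R.
  by exists (e %/ 2)%Z; lia.
pose f i := (f0 i + f1 i)%R.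
have inc i : (i < m)%R -> (f i <= f (i + 1))%R.
  by move=> lt_im; apply: lerD; [apply: (proj2 H0) | apply: (proj2 H1)]; lia.
have dec i : (m <= i)%R -> (f (i + 1) <= f i)%R.
  by move=> le_mi; apply: lerD; [apply: (symuni_dec H0) | apply: (symuni_dec H1)]; lia.
(* If [m] is negative, the coefficients decrease from index 0 on. *)
exists `|Num.max m 0|%N; split=> i j /andP[].
- move=> le_ij; elim: j le_ij => [|j IH]; first by rewrite leqn0 => /eqP->.
  rewrite leq_eqVlt => /orP[/eqP->//|lt_ij] le_jm.
  apply: le_trans (IH _ _) _; [lia | lia |].
  have -> : (p`_j.+1)%R = f (j%:Z + 1)%R by rewrite pE /f (_ : Posz j.+1 = (j%:Z + 1)%R) //; lia.
  by rewrite pE; apply: inc; lia.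
- move=> le_mi; elim: j => [|j IH]; first by rewrite leqn0 => /eqP->.
  rewrite leq_eqVlt => /orP[/eqP->//|lt_ij].
  apply: le_trans (IH _); last lia.
  have -> : (p`_j.+1)%R = f (j%:Z + 1)%R by rewrite pE /f (_ : Posz j.+1 = (j%:Z + 1)%R) //; lia.
  by rewrite pE; apply: dec; lia.
Qed.

(** * Eulerian polynomials of finite sets *)

Lemma des_cat a u b v :
  des ((a :: u) ++ b :: v) = des (a :: u) + (b < last a u) + des (b :: v).
Proof.
by elim: u a => [|c u IH] a; rewrite /des /= ?addn0 // -!addnA; congr (_ + _); rewrite addnA; exact: IH.
Qed.

Lemma des_cons a b v : des (a :: b :: v) = (b < a) + des (b :: v).
Proof. by []. Qed.

Definition words (T : finType) (A : {set T}) : seq (seq T) := permutations (enum A).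

Section Words.
Variable T : finType.
Implicit Types (A B I : {set T}) (u v w : seq T).

Lemma wordsP A w : reflect (uniq w /\ w =i A) (w \in words A).
Proof.
rewrite mem_permutations; apply: (iffP idP) => [H | [Uw wA]].
  by split=> [|x]; rewrite ?(perm_uniq H) ?enum_uniq // (perm_mem H) mem_enum.
by apply: uniq_perm; rewrite ?enum_uniq // => x; rewrite wA mem_enum.
Qed.

Lemma size_words A w : w \in words A -> size w = #|A|.
Proof. by rewrite mem_permutations cardE => /perm_size. Qed.

Lemma words_uniq A : uniq (words A).
Proof. exact: permutations_uniq. Qed.

Lemma words_cat A u v :
  u ++ v \in words A ->
  [/\ u \in words [set x in u], v \in words (A :\: [set x in u]) & [set x in u] \subset A].
Proof.
case/wordsP; rewrite cat_uniq => /and3P[Uu /hasPn dis Uv] eqA; split.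
- by apply/wordsP; split=> // x; rewrite inE.
- apply/wordsP; split=> // x; rewrite !inE -eqA mem_cat.
  by case: (boolP (x \in v)) => [/dis/negbTE->|_]; rewrite ?andbT ?orbT ?orbF ?andNb.
- by apply/subsetP=> x; rewrite inE -eqA mem_cat => ->.
Qed.

Lemma cat_words A I u v :
  A \subset I -> u \in words A -> v \in words (I :\: A) -> u ++ v \in words I.
Proof.
move=> /subsetP sAI /wordsP[Uu uA] /wordsP[Uv vA]; apply/wordsP; split.
  rewrite cat_uniq Uu Uv andbT /=; apply/hasPn=> x; rewrite vA inE => /andP[+ _].
  by rewrite /= uA.
move=> x; rewrite mem_cat uA vA inE.
by case: (boolP (x \in A)) => [/sAI->|].
Qed.

(** Serves to cut words at their largest letter ([m] is that letter) and after their first parity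
    block ([m] is empty). All words over [A] have the same length, so the cut is unique. *)
Lemma sum_words_split (V : nmodType) I A B (m : seq T) (Q R : pred (seq T)) (F : seq T -> V) :
  (forall u v, u \in words A -> v \in words B -> R v ->
     u ++ m ++ v \in words I /\ Q (u ++ m ++ v)) ->
  (forall w, w \in words I -> Q w ->
     exists u v, [/\ u \in words A, v \in words B, R v & w = u ++ m ++ v]) ->
  (\sum_(w <- words I | Q w) F w =
   \sum_(u <- words A) \sum_(v <- words B | R v) F (u ++ m ++ v))%R.
Proof.
move=> H1 H2.
pose L := [seq u ++ m ++ v | u <- words A, v <- filter R (words B)].
have E : perm_eq (filter Q (words I)) L.
  apply: uniq_perm; first exact: filter_uniq (words_uniq I).
    apply: allpairs_uniq; rewrite ?filter_uniq ?words_uniq //.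
    move=> [u v] [u' v'] /allpairsP[[a b] [/= aA _ [-> _]]] /allpairsP[[a' b'] [/= a'A _ [-> _]]] /= /eqP.
    rewrite eqseq_cat ?(size_words aA) ?(size_words a'A) // => /andP[/eqP->].
    by rewrite eqseq_cat // eqxx => /eqP->.
  move=> w; rewrite mem_filter; apply/andP/allpairsP.
    case=> Qw /H2/(_ Qw)[u [v [uA vB Rv ->]]]; exists (u, v); split=> //=.
    by rewrite mem_filter Rv.
  case=> -[u v] /= [uA]; rewrite mem_filter => /andP[Rv vB] ->.
  by have [? ?] := H1 _ _ uA vB Rv.
rewrite -big_filter (perm_big _ E) /= big_allpairs_dep /=.
by apply: eq_bigr => u _; rewrite big_filter.
Qed.

Variable k : T -> nat.
Hypothesis k_inj : injective k.

Let wt w : {poly int} := ('X^(des (map k w)))%R.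

Lemma words0 : words (set0 : {set T}) = [:: [::]].
Proof. by rewrite /words enum_set0. Qed.

Lemma des_max u M v :
  (forall x, x \in u -> k x < k M) -> (forall x, x \in v -> k x < k M) ->
  des (map k (u ++ M :: v)) = des (map k u) + (v != [::]) + des (map k v).
Proof.
have tail w : (forall x, x \in w -> k x < k M) ->
    des (map k (M :: w)) = (w != [::]) + des (map k w).
  by case: w => // x w ltM; rewrite [map _ _]/= des_cons ltM ?mem_head.
case: u => [|x u] ltu ltv; first by rewrite [in LHS]/= tail // add0n.
rewrite cat_cons map_cons map_cat map_cons des_cat -!map_cons tail // last_map.
by rewrite ltnNge ltnW ?ltu ?mem_last //= addn0 addnA.
Qed.

(* Words are split at their largest letter [M]; the terms with [M] first and with
   [M] last add up to a multiple of [1 + X]. *)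
Lemma eulerian_gam A : A != set0 -> gam (#|A|%:Z - 1)%R (\sum_(w <- words A) wt w)%R.
Proof.
move: {2}#|A| (leqnn #|A|) => n; elim: n A => [|n IH] A leAn Ann0.
  by rewrite -card_gt0 ltnNge leAn in Ann0.
have [x0 x0A] := set0Pn _ Ann0.
pose M := [arg max_(x > x0 in A) k x].
have [MA maxM] : M \in A /\ forall x, x \in A -> k x <= k M.
  by rewrite /M; case: arg_maxnP.
(* Words are grouped by the set [U] of letters to the left of [M]; the orders on the two sides are
   then independent. *)
pose pre w := [set x in take (index M w) w].
pose E B : {poly int} := (\sum_(w <- words B) wt w)%R.
have cardA : #|A| = #|A :\ M|.+1 by rewrite (cardsD1 M A) MA.
have ltM x : x \in A :\ M -> k x < k M.
  rewrite !inE => /andP[nxM xA]; rewrite ltn_neqAle maxM // andbT.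
  by apply: contra nxM => /eqP/k_inj->.
have preA w : w \in words A -> exists v,
    [/\ w = take (index M w) w ++ M :: v, pre w \subset A :\ M,
        take (index M w) w \in words (pre w) & v \in words (A :\ M :\: pre w)].
  move=> wA; have /wordsP[Uw eqA] := wA.
  have Mw : M \in w by rewrite eqA.
  exists (drop (index M w).+1 w).
  have wE : w = take (index M w) w ++ [:: M] ++ drop (index M w).+1 w.
    by rewrite -{1}(cat_take_drop (index M w) w) (drop_nth M) ?index_mem // nth_index.
  have /words_cat[uU MvV _] : take (index M w) w ++ M :: drop (index M w).+1 w \in words A.
    by rewrite -[_ ++ _]wE.
  have nMp : M \notin pre w by rewrite inE in_take // ltnn.
  split=> //.
    apply/subsetP=> x; rewrite !inE => xt; rewrite -eqA (mem_take xt) andbT.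
    by apply: contraNneq nMp => <-; rewrite inE.
  rewrite (_ : A :\ M :\: pre w = A :\: pre w :\: [set x in [:: M]]); last first.
    by apply/setP=> x; rewrite !inE andbCA.
  by have [] := words_cat (MvV : [:: M] ++ _ \in _).
have preE (U : {set T}) : (\sum_(w <- words A | pre w == U) wt w =
    if U \subset A :\ M then E U * ('X^(A :\ M :\: U != set0) * E (A :\ M :\: U)) else 0)%R.
  case: ifP => [sUA | nsUA]; last first.
    rewrite big_seq_cond big_pred0 // => w; apply/negbTE; apply: contraFN nsUA => /andP[wA /eqP<-].
    by have [v []] := preA w wA.
  set V := A :\ M :\: U.
  have nMU : M \notin U by apply/negP=> /(subsetP sUA); rewrite !inE eqxx.
  rewrite (@sum_words_split _ _ U V [:: M] _ xpredT).
  - rewrite /E big_distrl /= big_seq [RHS]big_seq; apply: eq_bigr => u uU.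
    rewrite !big_distrr /= big_seq [RHS]big_seq; apply: eq_bigr => v vV.
    have /wordsP[_ eqU] := uU; have /wordsP[_ eqV] := vV.
    rewrite /wt des_max ?exprD ?mulrA //.
    + have -> // : (v != [::]) = (V != set0).
      by rewrite -size_eq0 (size_words vV) cards_eq0.
    + by move=> x; rewrite eqU => /(subsetP sUA); exact: ltM.
    + by move=> x; rewrite eqV inE => /andP[_]; exact: ltM.
  - move=> u v uU vV _; split.
      apply: (@cat_words U) => //; first by apply: subset_trans sUA (subsetDl _ _).
      apply: (@cat_words [set M]); first by rewrite sub1set inE nMU.
        by apply/wordsP; split=> // x; rewrite !inE.
      rewrite (_ : _ :\: _ = V) //.
      by apply/setP=> x; rewrite !inE andbCA.
    have /wordsP[_ eqU] := uU.
    have nMu : M \notin u by rewrite eqU.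
    apply/eqP; apply/setP=> x.
    by rewrite inE index_cat (negbTE nMu) /= eqxx addn0 take_size_cat // eqU.
  - move=> w wA /eqP eqU; have [v [wE _]] := preA w wA; rewrite eqU => uU vV.
    by exists (take (index M w) w), v; split.
rewrite (partition_big pre xpredT) //= (eq_bigr _ (fun U _ => preE U)).
have E0 : E set0 = 1%R by rewrite /E words0 big_seq1.
have gamE (U : {set T}) : U \subset A :\ M -> U != set0 -> gam (#|U|%:Z - 1)%R (E U).
  move=> sU Un0; apply: IH => //; rewrite -ltnS (leq_trans _ leAn) // cardA ltnS.
  exact: subset_leq_card.
case: (eqVneq (A :\ M) set0) => [A0 | An0].
  rewrite cardA A0 cards0; apply: gam_sum => U _ _.
  rewrite subset0 set0D eqxx /= mul1r E0 mulr1; case: eqP => [->|_]; last exact: gam0.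
  by rewrite E0; exact: gam1.
rewrite (bigD1 set0) // (bigD1 (A :\ M)) //= sub0set subxx setDv setD0 eqxx An0 E0.
rewrite mul1r expr0 !mulr1 addrA; apply: gamD.
  apply: (gam_eq (gamM (gamB 0 1) (gamE _ (subxx _) An0))); first by rewrite cardA; lia.
  by rewrite !mul1r expr1 mulrDl mul1r addrC.
apply: gam_sum => U _ /andP[Un0 UnA]; case: ifP => [sU|_]; last exact: gam0.
have Vn0 : A :\ M :\: U != set0.
  by apply: contra UnA; rewrite setD_eq0 eqEsubset sU.
(* With [V] the letters after [M], the doubled centres add up to [(#|U| - 1) + 2 + (#|V| - 1)]; the
   2 comes from the descent after [M]. *)
rewrite Vn0; apply: (gam_eq (gamM (gamE _ sU Un0) (gamM (gamXn 1) (gamE _ (subsetDl _ _) Vn0)))) => //.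
by rewrite cardA -(cardsID U (A :\ M)) (setIidPr sU); lia.
Qed.
End Words.

(** * Linear extensions and parity blocks *)

Section Linear.
Variables (d : Order.disp_t) (T : finPOrderType d).
Implicit Types (A B I : {set T}) (u v w : seq T) (x y z : T).

Definition linear_word w := pairwise (fun x y => ~~ (y < x)%O) w.

Variables (par : T -> bool) (k : T -> nat).
Hypothesis k_inj : injective k.
Hypothesis k_par : forall x y, ~~ par x -> par y -> k x < k y.
Hypothesis par_between : forall x y, (x < y)%O -> par x = par y ->
  exists z, [/\ (x < z)%O, (z < y)%O & par z != par x].

(** Both predicates fail on the empty word, so the base case of [linear_gam] is an empty sum. *)
Definition starts e w := if w is x :: _ then par x == e else false.
Definition ends l w := if w is x :: w' then par (last x w') == l else false.

Definition upset I := forall x y, x \in I -> (x <= y)%O -> y \in I.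

(** The conditions on the set of letters of the leading run of parity [e]. That the run ends exactly
    after [B] concerns the next letter and is imposed by [R] in [linear_gam]. *)
Definition initial_block e I B :=
  [&& B \subset I, [forall x in B, par x == e] &
      [forall x in I :\: B, forall y in B, ~~ (x < y)%O]].

Lemma initial_blockP e I B :
  reflect [/\ B \subset I, forall x, x \in B -> par x = e &
             forall x y, x \in I :\: B -> y \in B -> ~~ (x < y)%O]
          (initial_block e I B).
Proof.
apply: (iffP and3P) => -[sBI parB nlt]; split=> //.
- by move=> x /(forall_inP parB)/eqP.
- by move=> x y /(forall_inP nlt)/forall_inP; apply.
- by apply/forall_inP=> x /parB->.
- by apply/forall_inP=> x xI; apply/forall_inP=> y; apply: nlt.
Qed.

Lemma upsetD e I B : upset I -> initial_block e I B -> upset (I :\: B).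
Proof.
move=> upI /initial_blockP[_ _ nlt] x y xIB le_xy.
have [xI nxB] : x \in I /\ x \notin B by move: xIB; rewrite inE => /andP[].
rewrite inE (upI x) // andbT; apply/negP=> yB.
have /negP[] := nlt _ _ xIB yB.
by rewrite lt_neqAle le_xy andbT; apply: contraNneq nxB => ->.
Qed.

(** The block may be ordered freely because it is an antichain: an element of the other parity
    between two of its letters would be in the up-set [I], outside [B], and below a letter of
    [B]. *)
Lemma initial_block_linear e I B u v : upset I -> initial_block e I B ->
  u \in words B -> v \in words (I :\: B) -> linear_word (u ++ v) = linear_word v.
Proof.
move=> upI /initial_blockP[/subsetP sBI parB nlt].
move=> /wordsP[_ uB] /wordsP[_ vIB].
rewrite /linear_word pairwise_cat andbA (_ : allrel _ _ _ && _ = true) //; apply/andP; split.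
  by apply/allrelP=> x y; rewrite uB vIB => xB yIB; apply: nlt.
apply: (sub_in_pairwise (P := mem B) (r := fun _ _ => true)) => [x y xB yB _||].
  (* between two comparable letters of equal parity lies one of the other parity *)
- apply/negP=> lt_yx.
  have [|z [lt_yz lt_zx /eqP[]]] := par_between lt_yx.
    by rewrite !parB.
  have zI : z \in I by apply: upI (sBI y yB) (ltW lt_yz).
  case: (boolP (z \in B)) => [zB | nzB].
    by rewrite !parB.
  by have := nlt z x; rewrite inE nzB zI lt_zx xB => /(_ isT isT).
- by apply/allP=> x; rewrite uB.
- by elim: (u) => //= x s ->; rewrite all_predT.
Qed.

(** A block [B] adds [#|B| - 1] to the doubled centre, and the passage from parity [e] to [~~ e]
    adds [2 e = 1 + (e - ~~ e)]. The sum telescopes, so only the first and last parities matter. *)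
Lemma linear_gam n (e l : bool) I : upset I -> #|I| <= n ->
  gam (#|I|%:Z - 1 + (e%:Z - l%:Z))%R
    (\sum_(w <- words I | [&& linear_word w, starts e w & ends l w]) 'X^(des (map k w)))%R.
Proof.
elim: n e I => [|n IH] e I upI leIn.
  move: leIn; rewrite leqn0 cards_eq0 => /eqP->.
  rewrite words0 big_cons big_nil /=; exact: gam0.
pose blk w := [set x in take (find (fun x => par x != e) w) w].
rewrite (partition_big blk xpredT) //=; apply: gam_sum => B _ _.
have blkP w : w \in words I -> linear_word w -> starts e w ->
  initial_block e I (blk w) /\ blk w != set0.
  move=> wI lw sw; split; last first.
    case: w sw {wI lw} => //= x w /eqP parx; apply/set0Pn; exists x.
    by rewrite inE /= parx eqxx /= mem_head.
  have := wI; rewrite -{1}(cat_take_drop (find (fun x => par x != e) w) w).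
  case/words_cat=> _ /wordsP[_ vIB] sBI; apply/initial_blockP; split=> //.
  - move=> x; rewrite inE => xu; apply/eqP/negPn.
    have : ~~ has (fun x => par x != e) (take (find (fun x => par x != e) w) w).
      by rewrite has_take_leq ?ltnn ?find_size.
    by move/hasPn; apply.
  - move=> x y; rewrite -vIB inE => xv yu; move: lw.
    rewrite -{1}(cat_take_drop (find (fun x => par x != e) w) w) /linear_word pairwise_cat.
    by case/and3P=> /allrelP/(_ y x yu xv).
case: (boolP (initial_block e I B && (B != set0))) => [/andP[ibB Bn0] | nB]; last first.
  rewrite big_seq_cond big_pred0; first exact: gam0.
  move=> w; apply: contraNF nB => /and3P[wI /and3P[lw sw _] /eqP<-].
  by have [-> ->] := blkP w wI lw sw.
(* If nothing follows the block, the word ends with parity [e], which must then be [l]. *)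
pose R v := [&& linear_word v & if I :\: B == set0 then e == l else starts (~~ e) v && ends l v].
rewrite (@sum_words_split _ _ I B (I :\: B) [::] _ R).
(* The junction is a descent exactly when the block is odd and something follows it, since even
   labels are smaller than odd ones. *)
- have -> : (\sum_(u <- words B) \sum_(v <- words (I :\: B) | R v) 'X^(des (map k (u ++ [::] ++ v))) =
     (\sum_(u <- words B) 'X^(des (map k u))) *
     ('X^(e && (I :\: B != set0)) * \sum_(v <- words (I :\: B) | R v) 'X^(des (map k v))) :> {poly int})%R.
    rewrite big_distrl /= big_seq [RHS]big_seq; apply: eq_bigr => u uB.
    rewrite mulr_sumr mulr_sumr big_seq_cond [RHS]big_seq_cond; apply: eq_bigr => v /andP[vIB Rv].
    rewrite -!exprD; congr ('X^_)%R; rewrite addnA.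
    have [_ parB _] := initial_blockP _ _ _ ibB.
    have /wordsP[_ eqB] := uB; move: Rv; rewrite /R -cards_eq0 -(size_words vIB).
    case: v vIB => [|y v] vIB /=; first by rewrite cats0 andbF !addn0.
    case/and3P=> _ /eqP pary _; rewrite andbT.
    have := size_words uB; case: u {uB} eqB => [|x u] eqB.
      by move=> /esym/eqP; rewrite cards_eq0 (negbTE Bn0).
    move=> _; rewrite /= map_cat /= (des_cat (k x)) last_map; congr (_ + nat_of_bool _ + _).
    have : par (last x u) = e by apply: parB; rewrite -eqB mem_last.
    case: (e) pary => pary parx; first by rewrite k_par ?pary ?parx.
    by apply/negbTE; rewrite -leqNgt ltnW // k_par ?pary ?parx.
  have gamB := eulerian_gam k_inj Bn0.
  have cardI : #|I| = #|B| + #|I :\: B|.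
    by rewrite -(cardsID B I) (setIidPr _) //; case/and3P: ibB.
  case: (eqVneq (I :\: B) set0) => [E|IBn0].
    rewrite E words0 big_cons big_nil /= /R E eqxx /= andbF mul1r addr0.
    case: eqP => [->|_]; last by rewrite mulr0; apply: gam0.
    by rewrite mulr1; apply: (gam_eq gamB) => //; rewrite cardI E cards0; lia.
  have := IH (~~ e) (I :\: B) (upsetD upI ibB).
  rewrite -ltnS (leq_trans _ leIn); last first.
    by rewrite cardI -add1n leq_add2r card_gt0.
  move=> /(_ isT) gamIB; rewrite andbT.
  apply: (gam_eq (gamM gamB (gamM (gamXn e) gamIB))).
    by rewrite cardI; case: (e); lia.
  by rewrite /R (negbTE IBn0).
- move=> u v uB vIB /andP[lv Rv] /=.
  have [sBI parB _] := initial_blockP _ _ _ ibB.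
  have /wordsP[_ eqB] := uB.
  split; first exact: cat_words uB vIB.
  rewrite (initial_block_linear upI ibB) // lv /=.
  have := size_words uB; case: u {uB} eqB => [|x u] eqB.
    by move=> /esym/eqP; rewrite cards_eq0 (negbTE Bn0).
  move=> _; rewrite /= parB -?eqB ?mem_head // eqxx last_cat /=.
  have nhas : ~~ has (fun x => par x != e) (x :: u).
    by apply/hasPn=> z; rewrite eqB => /parB->; rewrite eqxx.
  move: Rv; rewrite -cards_eq0 -(size_words vIB).
  case: v {lv} vIB => [|y v] vIB /=.
    move/eqP=> <-; rewrite parB -?eqB ?mem_last // eqxx cats0 /=.
    rewrite /blk hasNfind // take_size; apply/eqP/setP=> z; by rewrite inE eqB.
  case/andP=> pary ->; rewrite /blk -cat_cons find_cat (negbTE nhas) /=.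
  rewrite (eqP pary) (_ : (~~ e != e)) ?addn0 ?take_size_cat //=; last by case: (e).
  by apply/eqP/setP=> z; rewrite inE eqB.
- move=> w wI /andP[/and3P[lw sw ew] /eqP eqB].
  set p := fun x => par x != e.
  exists (take (find p w) w), (drop (find p w) w).
  have := wI; rewrite -{1}(cat_take_drop (find p w) w).
  rewrite -/(blk w) => /words_cat; rewrite -/(blk w) eqB => -[uB vIB _].
  have /wordsP[_ eqBu] := uB.
  have [_ parB _] := initial_blockP _ _ _ ibB.
  split=> //; last by rewrite cat_take_drop.
  move: lw ew; rewrite -{1 2}(cat_take_drop (find p w) w) /R /linear_word pairwise_cat.
  case/and3P=> _ _ -> /=; rewrite -cards_eq0 -(size_words vIB) size_drop subn_eq0.
  case: ifP => [le_wf | nle_wf].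
    rewrite drop_oversize // cats0.
    case: (take _ _) eqBu => //= x u eqBu.
    by rewrite parB -?eqBu ?mem_last // eq_sym.
  have fw : find p w < size w by rewrite ltnNge nle_wf.
  have hasp : has p w by rewrite has_find.
  case: w {wI eqB uB vIB eqBu nle_wf} sw fw hasp => // x0 w sw fw hasp.
  rewrite (drop_nth x0) //; have := nth_find x0 hasp.
  set y := nth _ _ _ => py.
  have -> : starts (~~ e) (y :: drop (find p (x0 :: w)).+1 (x0 :: w)).
    by move: py; rewrite /= /p; case: (par y); case: (e).
  case: (take _ _) => [|x u] //=.
  by rewrite last_cat.
Qed.
End Linear.

(** * Counting compatible maps *)

Section Before.
Variables (T : finType) (k : T -> nat).
Hypothesis k_inj : injective k.
Implicit Types (z : T -> int) (s : seq T).

(** Ties in value are broken by the label, as in a (P, [k])-partition. *)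
Definition before z x y := (z x < z y)%R || (z x == z y) && (k x < k y).

Lemma before_trans z : transitive (before z).
Proof. rewrite /before => y x t; lia. Qed.

Lemma before_irr z : irreflexive (before z).
Proof. rewrite /before => x; lia. Qed.

Lemma before_total z x y : x != y -> ~~ before z y x -> before z x y.
Proof.
rewrite -(inj_eq k_inj) /before; lia.
Qed.

Lemma before_le z x y : before z x y -> (z x <= z y)%R.
Proof. rewrite /before; lia. Qed.

Lemma beforeE z x y : x != y -> before z x y = (z x + (k y < k x)%:Z <= z y)%R.
Proof.
by rewrite -(inj_eq k_inj) /before; case: (ltngtP (k x) (k y)) => //= _ _; lia.
Qed.

Definition sort_before z : seq T := sort (fun x y => ~~ before z y x) (enum T).

Lemma sort_before_words z : sort_before z \in words [set: T].
Proof.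
apply/wordsP; split; first by rewrite sort_uniq enum_uniq.
by move=> x; rewrite mem_sort mem_enum !inE.
Qed.

Lemma sort_before_sorted z : sorted (before z) (sort_before z).
Proof.
case E: (sort_before z) => [//|x0 s']; rewrite -E.
have /wordsP[U _] := sort_before_words z.
have: sorted (fun x y => ~~ before z y x) (sort_before z).
  by apply: sort_sorted => x y; rewrite /before; lia.
move/(sortedP x0) => S; apply/(sortedP x0) => i lti; apply: before_total; last exact: S.
by rewrite nth_uniq // ?(ltnW lti) //; rewrite neq_ltn ltnSn.
Qed.

Lemma sorted_before_eq z s : s \in words [set: T] -> sorted (before z) s -> s = sort_before z.
Proof.
move=> /wordsP[_ sT] S; apply: (irr_sorted_eq (@before_trans z) (@before_irr z)) => //.
  exact: sort_before_sorted.
by have /wordsP[_ E] := sort_before_words z; move=> x; rewrite sT E.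
Qed.

(** The least rise from position 0 to position [i] of an integer map sorted by [s]. *)
Definition des_upto s i := des (map k (take i.+1 s)).

Lemma des_upto0 s : des_upto s 0 = 0.
Proof. by case: s => [|x [|y s]]. Qed.

Lemma des_upto_last s : des_upto s (size s).-1 = des (map k s).
Proof. by rewrite /des_upto; case: s => //= x s; rewrite take_size. Qed.

Lemma des_uptoS x0 s i : i.+1 < size s ->
  des_upto s i.+1 = des_upto s i + (k (nth x0 s i.+1) < k (nth x0 s i)).
Proof.
move=> lti; rewrite /des_upto (take_nth x0 lti) -cats1 map_cat /=.
rewrite (take_nth x0 (ltnW lti)).
case E: (rcons _ _) => [|a u]; first by case: (take i s) E.
rewrite /= -cat_cons des_cat -map_cons -E /= addn0 last_map.
by have -> : last a u = nth x0 s i by rewrite -(last_cons a) -E last_rcons.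
Qed.

Lemma sorted_beforeP x0 z s : uniq s ->
  reflect (forall i, i.+1 < size s ->
     (z (nth x0 s i) - (des_upto s i)%:Z <= z (nth x0 s i.+1) - (des_upto s i.+1)%:Z)%R)
  (sorted (before z) s).
Proof.
move=> Us; apply: (iffP (sortedP x0)) => H i lti; have := H i lti;
  have nx : nth x0 s i != nth x0 s i.+1 by rewrite nth_uniq ?(ltnW lti) // neq_ltn ltnSn.
all: rewrite (beforeE _ nx) (des_uptoS x0 lti); lia.
Qed.
End Before.

Section Counting.
Variables (d : Order.disp_t) (T : finPOrderType d) (k : T -> nat) (c : T -> int).
Hypothesis k_inj : injective k.

Definition compatible (z : T -> int) := forall x y : T, (x < y)%O -> before k z x y.

(** Together with [c_bound], this reduces the requirement [0 <= z - c <= n] on all elements to the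
    two ends of the sorted word. *)
Hypothesis c_min : forall x : T, (forall y : T, ~~ (y < x)%O) -> c x = 0%R.
Hypothesis c_bound : forall z, compatible z -> (forall x, 0 <= z x)%R ->
  forall l, maximal l -> (forall x, x != l -> before k z x l) ->
  forall x, (0 <= z x - c x <= z l - c l)%R.

Variable n : nat.
Variable F : {set {ffun T -> 'I_n.+1}}.
Hypothesis FP : forall sg : {ffun T -> 'I_n.+1},
  reflect (compatible (fun x => (sg x)%:Z + c x)%R) (sg \in F).

Lemma linear_nth (x0 : T) (s : seq T) i j : linear_word s -> i < j < size s -> ~~ (nth x0 s j < nth x0 s i)%O.
Proof.
move=> /(pairwiseP x0) H /andP[ij js]; apply: H => //; rewrite inE //.
exact: ltn_trans js.
Qed.

Lemma sorted_compatible z s : s \in words [set: T] -> linear_word s ->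
  sorted (before k z) s -> compatible z.
Proof.
move=> /wordsP[Us sT] lin S x y ltxy.
have [xs ys] : x \in s /\ y \in s by rewrite !sT !inE.
have ij : index x s < index y s.
  rewrite ltnNge leq_eqVlt negb_or; apply/andP; split.
    by apply: contraTneq ltxy => E; rewrite -(nth_index x ys) E nth_index // ltxx.
  apply/negP=> ji; have := @linear_nth x s (index y s) (index x s) lin.
  by rewrite ji index_mem xs !nth_index // ltxy => /(_ isT).
have := sorted_ltn_nth (@before_trans _ k z) x S.
by move=> /(_ (index x s) (index y s)); rewrite !inE !index_mem !nth_index //; apply.
Qed.

Lemma compatible_linear z (s : seq T) :
  sorted (before k z) s -> compatible z -> linear_word s.
Proof.
rewrite sorted_pairwise; last exact: before_trans.
move=> S cz; apply: sub_pairwise S => x y bxy; apply/negP=> /cz byx.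
by have := before_trans bxy byx; rewrite before_irr.
Qed.

(** Each map in [F] is sorted by exactly one word, its [sort_before], and compatibility makes this
    word linear. *)
Lemma card_F_sum :
  #|F| = \sum_(s <- words [set: T] | linear_word s)
            #|[set sg in F | sorted (before k (fun x => (sg x)%:Z + c x)%R) s]|.
Proof.
transitivity (\sum_(s <- words [set: T] | linear_word s)
   \sum_(sg in F) (sorted (before k (fun x => (sg x)%:Z + c x)%R) s : nat)); last first.
  apply: eq_bigr => s _; rewrite -sum1_card big_mkcond [RHS]big_mkcond /=.
  by apply: eq_bigr => sg _; rewrite inE; case: (sg \in F) => //=; case: ifP.
rewrite exchange_big /= -sum1_card; apply: eq_bigr => sg /FP csg.
set z := fun x => ((sg x)%:Z + c x)%R.
have sT := sort_before_words k z; have S := sort_before_sorted k_inj z.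
rewrite big_mkcond (bigD1_seq (sort_before k z)) ?words_uniq //=.
rewrite (compatible_linear S csg) S big1_seq // => s /andP[ne s'T].
case: ifP => // _; apply/eqP; rewrite eqb0; apply: contra ne => S'.
by rewrite (sorted_before_eq k_inj s'T S').
Qed.

Lemma ends_bounds (x0 : T) z s : s \in words [set: T] -> linear_word s -> sorted (before k z) s ->
  [/\ compatible z, c (nth x0 s 0) = 0%R, maximal (last x0 s) &
      forall x, x != last x0 s -> before k z x (last x0 s)].
Proof.
move=> sw lin S; have cz := sorted_compatible sw lin S.
have /wordsP[Us s_all] := sw.
have sT x : x \in s by rewrite s_all inE.
have ix x : index x s < size s by rewrite index_mem sT.
have first x : x != nth x0 s 0 -> before k z (nth x0 s 0) x.
  move=> ne; rewrite -[X in before k z _ X](nth_index x0 (sT x)).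
  have := sorted_ltn_nth (@before_trans _ k z) x0 S; apply; rewrite ?inE //.
    exact: leq_ltn_trans (ix x).
  by rewrite lt0n; apply: contra ne => /eqP E; rewrite -E nth_index ?sT.
have lst x : x != last x0 s -> before k z x (last x0 s).
  move=> ne; rewrite -[X in before k z X _](nth_index x0 (sT x)).
  rewrite -nth_last; have := sorted_ltn_nth (@before_trans _ k z) x0 S.
  have := ix x; case E: (size s) => [//|m] /= ltm; apply; rewrite ?inE ?E //.
  move: ltm; rewrite ltnS leq_eqVlt => /orP[/eqP Em|//].
  by case/eqP: ne; rewrite -nth_last E -Em nth_index ?sT.
split=> //.
  apply: c_min => y; apply/negP=> lt; have := before_trans (cz _ _ lt).
  case: (eqVneq y (nth x0 s 0)) lt => [->|/first b _ /(_ _ b)]; first by rewrite ltxx.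
  by rewrite before_irr.
apply/forallP=> y; apply/implyP; rewrite le_eqVlt eq_sym => /orP[//|lt].
case: (eqVneq y (last x0 s)) lt => [->|/lst b lt]; first by rewrite ltxx.
by have := before_trans b (cz _ _ lt); rewrite before_irr.
Qed.

Lemma nth_bounds (x0 : T) z s i : s \in words [set: T] -> linear_word s -> sorted (before k z) s ->
  i < size s ->
  (z (nth x0 s 0) <= z (nth x0 s i) - (des_upto k s i)%:Z <= z (last x0 s) - (des (map k s))%:Z)%R.
Proof.
move=> sw lin S lti; have /wordsP[Us _] := sw.
have step := sorted_beforeP k_inj x0 z Us S.
have mono i' j : i' <= j -> j < size s ->
   (z (nth x0 s i') - (des_upto k s i')%:Z <= z (nth x0 s j) - (des_upto k s j)%:Z)%R.
  elim: j => [|j IH]; first by rewrite leqn0 => /eqP->.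
  rewrite leq_eqVlt => /orP[/eqP->//|le_ij] ltj.
  exact: le_trans (IH le_ij (ltnW ltj)) (step _ ltj).
apply/andP; split.
  have := mono 0 i isT lti; rewrite des_upto0; lia.
rewrite -des_upto_last -nth_last; apply: mono; move: lti; case: (size s) => //.
Qed.

(** For a linear word listing an inhabited [T], the least [n] such that some map into [{0, ..., n}]
    is sorted by [s]; see [card_fiber]. *)
Definition dstat (s : seq T) : int :=
  if s is x :: _ then ((des (map k s))%:Z - c (last x s))%R else 0%R.

Lemma dstatE x0 s : s \in words [set: T] -> dstat s = ((des (map k s))%:Z - c (last x0 s))%R.
Proof. by case: s => // /wordsP[_ /(_ x0)]; rewrite !inE. Qed.

Lemma c_bound_sorted (x0 : T) z s : s \in words [set: T] -> linear_word s ->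
  sorted (before k z) s -> (0 <= z (nth x0 s 0))%R ->
  forall x, (0 <= z x - c x <= z (last x0 s) - c (last x0 s))%R.
Proof.
move=> sw lin S z0; have [cz _ mx bl] := ends_bounds x0 sw lin S.
have /wordsP[_ s_all] := sw.
apply: c_bound => // x; have xs : x \in s by rewrite s_all inE.
have := nth_bounds x0 sw lin S (_ : index x s < size s); rewrite index_mem nth_index // => /(_ xs).
lia.
Qed.

(** Rebuilds a map sorted by [s] from a weakly increasing sequence by adding back the descents
    passed. *)
Definition word_fun (t : seq nat) (s : seq T) (x : T) : int :=
  Posz (nth 0 t (index x s) + des_upto k s (index x s)).

Lemma word_fun_nth x0 t s i : uniq s -> i < size s ->
  word_fun t s (nth x0 s i) = Posz (nth 0 t i + des_upto k s i).
Proof. by move=> Us lti; rewrite /word_fun index_uniq. Qed.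

Lemma word_fun_sorted (x0 : T) t s : uniq s -> size t = size s ->
  sorted leq t -> sorted (before k (word_fun t s)) s.
Proof.
move=> Us st /(sortedP 0) H; apply/(sorted_beforeP k_inj x0 _ Us) => i lti.
rewrite !word_fun_nth ?(ltnW lti) //; have := H i; rewrite st => /(_ lti); lia.
Qed.

(** [c_bound] is applied to the least nonnegative map sorted by [s], whose value at the last letter
    is the number of descents. *)
Lemma dstat_ge0 (x0 : T) s : s \in words [set: T] -> linear_word s -> (0 <= dstat s)%R.
Proof.
move=> sw lin; have /wordsP[Us s_all] := sw.
pose t := nseq (size s) 0.
have S : sorted (before k (word_fun t s)) s.
  apply: (word_fun_sorted x0) => //; first by rewrite size_nseq.
  by apply/(sortedP 0) => i; rewrite size_nseq => lti; rewrite !nth_nseq !if_same.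
have s0 : 0 < size s by rewrite lt0n; apply/eqP=> /size0nil E; have := s_all x0; rewrite E !inE.
have /andP[+ _] := c_bound_sorted (x0 := x0) sw lin S isT (last x0 s).
rewrite (dstatE x0 sw).
by rewrite -nth_last word_fun_nth ?prednK // nth_nseq if_same add0n des_upto_last.
Qed.

(* Subtracting from each value the number of descents before it turns the maps
   sorted by [s] into arbitrary weakly increasing sequences. *)
Lemma card_fiber (x0 : T) s : s \in words [set: T] -> linear_word s ->
  #|[set sg in F | sorted (before k (fun x => (sg x)%:Z + c x)%R) s]| =
  if (dstat s <= n)%R then 'C(#|T| + `|(n%:Z - dstat s)%R|, #|T|) else 0.
Proof.
move=> sw lin; have /wordsP[Us s_all] := sw.
have sT x : x \in s by rewrite s_all inE.
have szs : size s = #|T| by rewrite (size_words sw) cardsT.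
have s0 : 0 < size s by case: (s) (sT x0).
have lst : last x0 s = nth x0 s (size s).-1 by rewrite nth_last.
case: ifP => [leDn | /negbT nleDn]; last first.
  apply/eqP; rewrite cards_eq0 -subset0; apply/subsetP=> sg; rewrite !inE => /andP[sgF S].
  case/negP: nleDn; rewrite (dstatE x0 sw).
  have [_ c0 _ _] := ends_bounds x0 sw lin S.
  have /andP[H1 H2] := nth_bounds x0 sw lin S s0.
  have := le_trans H1 H2; rewrite /= c0; have := ltn_ord (sg (last x0 s)); lia.
have D0 := dstat_ge0 x0 sw lin.
(* At the last letter, [sg] equals the last entry of the sequence plus [dstat s]; so [sg <= n] there
   means that the entry is at most [m = n - dstat s]. *)
set m := `|_|%N; rewrite -card_sorted_tuples.
set B := [set t : _.-tuple _ | _].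
pose vt (t : #|T|.-tuple 'I_m.+1) := map val t.
pose Psi (t : #|T|.-tuple 'I_m.+1) : {ffun T -> 'I_n.+1} :=
  [ffun x => inord `|word_fun (vt t) s x - c x|%N].
have szt t : size (vt t) = size s by rewrite size_map size_tuple.
have SB t : t \in B -> sorted (before k (word_fun (vt t) s)) s.
  by rewrite inE => St; apply: (word_fun_sorted x0).
(* By [c_bound] the shifted value lies in [[0, n]], so the absolute value and [inord] in [Psi] do
   not alter it. *)
have PsiE t x : t \in B -> ((Psi t x)%:Z + c x = word_fun (vt t) s x)%R.
  move=> tB; have := c_bound_sorted (x0 := x0) sw lin (SB t tB) isT x.
  have : (word_fun (vt t) s (last x0 s) - c (last x0 s) <= n)%R.
    rewrite {1}lst word_fun_nth ?prednK // des_upto_last.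
    have : nth 0 (vt t) (size s).-1 <= m.
      by rewrite (nth_map ord0) ?size_tuple -?szs ?prednK // -ltnS ltn_ord.
    move: leDn D0; rewrite /m (dstatE x0 sw); set cl := c _; set ds := des _; set y := nth _ _ _; clearbody cl ds y; lia.
  rewrite ffunE; move=> H1 H2; rewrite inordK; lia.
have PsiS t : t \in B -> Psi t \in [set sg in F | sorted (before k (fun x => (sg x)%:Z + c x)%R) s].
  move=> tB; have eqb x y : before k (fun x => (Psi t x)%:Z + c x)%R x y = before k (word_fun (vt t) s) x y.
    by rewrite /before !PsiE.
  rewrite inE (eq_sorted eqb) SB // andbT; apply/FP => x y ltxy; rewrite eqb.
  exact: (sorted_compatible sw lin (SB t tB)).
rewrite -(card_in_imset (f := Psi) (D := B)); last first.
  move=> t t' tB t'B E; apply: val_inj; apply: (inj_map val_inj).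
  apply: (eq_from_nth (x0 := 0)) => [|i]; first by rewrite !size_map !size_tuple.
  rewrite szt => lti.
  have := PsiE t (nth x0 s i) tB; rewrite E PsiE // !word_fun_nth //.
  by move=> [/addIn].
congr #|pred_of_set _|; apply/setP=> sg; apply/idP/imsetP => [|[t tB ->]]; last exact: PsiS.
rewrite inE => /andP[sgF S].
pose z (x : T) : int := ((sg x)%:Z + c x)%R; have {}S : sorted (before k z) s by exact: S.
have [_ c0 _ _] := ends_bounds x0 sw lin S.
have bnd i (lti : i < size s) : (0 <= z (nth x0 s i) - (des_upto k s i)%:Z <= m%:Z)%R.
  have /andP[H1 H2] := nth_bounds x0 sw lin S lti; apply/andP; split.
    by apply: le_trans H1; rewrite /z /= c0; lia.
  apply: le_trans H2 _; rewrite /z /m /=; have := ltn_ord (sg (last x0 s)).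
  move: leDn D0; rewrite (dstatE x0 sw); set cl := c _; set ds := des _; set y := nat_of_ord _.
  by clearbody cl ds y; lia.
pose t := [tuple (inord `|(z (nth x0 s i) - (des_upto k s i)%:Z)%R|%N : 'I_m.+1) | i < #|T|].
have tE i : i < size s -> nth 0 (vt t) i = `|(z (nth x0 s i) - (des_upto k s i)%:Z)%R|%N.
  move=> lti; have lti' : i < #|T| by rewrite -szs.
  rewrite (nth_map ord0) ?size_tuple // -(tnth_nth _ t (Ordinal lti')) tnth_mktuple /= inordK //.
  by have := bnd i lti; lia.
have tB : t \in B.
  rewrite inE; apply/(sortedP 0) => i; rewrite szt => lti.
  rewrite !tE ?(ltnW lti) //; have := bnd _ lti; have := bnd _ (ltnW lti).
  have := sorted_beforeP k_inj x0 z Us S _ lti.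
  by set a := (_ - _)%R; set b := (_ - _)%R; clearbody a b; lia.
exists t => //; apply/ffunP=> x; apply: val_inj.
have lti : index x s < size s by rewrite index_mem.
have := PsiE t x tB; have := bnd _ lti; rewrite /word_fun tE // nth_index // /z /=.
set cx := c x; set y := nat_of_ord _; set y' := nat_of_ord _; set e := des_upto _ _ _.
by clearbody cx y y' e; lia.
Qed.
End Counting.

(** * Covers and ranks *)

Lemma sum_count (S : Type) (r : seq S) (D : S -> nat) (f : nat -> nat) N :
  (forall b, N <= b -> f b = 0) ->
  \sum_(s <- r) f (D s) = \sum_(b < N) count (fun s => D s == b) r * f b.
Proof.
move=> f0; elim: r => [|s r IH]; first by rewrite big_nil big1.
rewrite big_cons IH /=; under [RHS]eq_bigr => b _ do rewrite mulnDl.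
rewrite big_split /=; congr (_ + _).
case: (ltnP (D s) N) => [ltN | leN].
  rewrite (bigD1 (Ordinal ltN)) //= eqxx mul1n big1 ?addn0 // => b.
  by rewrite -val_eqE eq_sym /= => /negbTE->.
rewrite f0 // big1 // => b _; rewrite (_ : (D s == b) = false) //.
by apply/negbTE; rewrite neq_ltn (leq_trans (ltn_ord b) leN) orbT.
Qed.

(* The system is unitriangular in the counts: take [n = a]. *)
Lemma binomial_sum_inj (S : Type) (r : seq S) (D1 D2 : S -> nat) p :
  (forall n, \sum_(s <- r) (if D1 s <= n then 'C(p + (n - D1 s), p) else 0) =
             \sum_(s <- r) (if D2 s <= n then 'C(p + (n - D2 s), p) else 0)) ->
  forall a, count (fun s => D1 s == a) r = count (fun s => D2 s == a) r.
Proof.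
move=> H a; have [n] := ubnP a; elim: n a => // n IH a lt_an.
pose f b := if b <= a then 'C(p + (a - b), p) else 0.
have f0 b : a.+1 <= b -> f b = 0 by move=> lt_ab; rewrite /f leqNgt lt_ab.
have := H a; rewrite -!/(f _) (sum_count r D1 f0) (sum_count r D2 f0) !big_ord_recr /=.
rewrite (eq_bigr (fun b : 'I_a => count (fun s => D2 s == b) r * f b)); last first.
  by move=> b _; rewrite IH // (leq_trans (ltn_ord b)).
by move/addnI; rewrite /f leqnn subnn addn0 binn !muln1.
Qed.

Section Poset.
Variables (d : Order.disp_t) (T : finPOrderType d).
Implicit Types (x y z w : T).

Definition covers x y := (x < y)%O && [forall z, ~~ ((x < z)%O && (z < y)%O)].

(** Induction on the size of the open interval: an element inside splits it into two smaller
    ones. *)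
Lemma covers_ind (r : T -> T -> Prop) :
  (forall y x z, r x y -> r y z -> r x z) -> (forall x y, covers x y -> r x y) ->
  forall x y, (x < y)%O -> r x y.
Proof.
move=> r_trans r_cov x y; pose I x y := [set z | (x < z)%O && (z < y)%O].
have [n] := ubnP #|I x y|; elim: n x y => // n IH x y leI ltxy.
case: (boolP (covers x y)) => [/r_cov//|].
rewrite /covers ltxy /= negb_forall => /existsP[z /negPn/andP[xz zy]].
apply: (r_trans z); apply: IH => //; rewrite -ltnS (leq_trans _ leI) // ltnS; apply: proper_card.
  apply/properP; split; last by exists z; rewrite inE ?ltxx ?andbF ?xz.
  by apply/subsetP=> w; rewrite !inE => /andP[-> wz]; exact: lt_trans wz zy.
apply/properP; split; last by exists z; rewrite inE ?ltxx ?andbF ?xz.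
by apply/subsetP=> w; rewrite !inE => /andP[zw ->]; rewrite (lt_trans xz zw).
Qed.

Lemma covers_below x y : (x < y)%O -> exists2 z, (x <= z)%O & covers z y.
Proof.
move=> ltxy.
(* The conjunct [x <= y] makes the property transitive, as [covers_ind] requires. *)
suff [] : (x <= y)%O /\ exists2 z, (x <= z)%O & covers z y by [].
move: x y ltxy; apply: covers_ind => [y x z [xy _] [yz [w yw cw]] | x y cxy].
  by split; [apply: le_trans yz | exists w => //; apply: le_trans yw].
by split; [case/andP: cxy => /ltW | exists x].
Qed.

Lemma minimal_below x : exists2 m, (m <= x)%O & forall y, ~~ (y < m)%O.
Proof.
have [n] := ubnP #|[set y | (y < x)%O]|; elim: n x => // n IH x.
case: (pickP (fun y => (y < x)%O)) => [y yx | none] len; last first.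
  by exists x => // y; rewrite none.
have [|m my mm] := IH y; last by exists m => //; apply: le_trans my (ltW yx).
rewrite -ltnS (leq_trans _ len) // ltnS; apply: proper_card.
apply/properP; split; last by exists y; rewrite inE ?ltxx.
by apply/subsetP=> w; rewrite !inE => wy; exact: lt_trans wy yx.
Qed.

Lemma maximal_above x : exists2 m, (x <= m)%O & maximal m.
Proof.
have [n] := ubnP #|[set y | (x < y)%O]|; elim: n x => // n IH x.
case: (pickP (fun y => (x < y)%O)) => [y xy | none] len; last first.
  exists x => //; apply/forallP=> y; apply/implyP; rewrite le_eqVlt none orbF eq_sym.
  by [].
have [|m my mm] := IH y; last by exists m => //; apply: le_trans (ltW xy) my.
rewrite -ltnS (leq_trans _ len) // ltnS; apply: proper_card.
apply/properP; split; last by exists y; rewrite inE ?ltxx.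
by apply/subsetP=> w; rewrite !inE; exact: lt_trans xy.
Qed.

Lemma max_chain_min x : (forall y, ~~ (y < x)%O) -> max_chain x [:: x].
Proof.
move=> mx; split=> //=; first by rewrite lexx.
move=> w; rewrite le_eqVlt (negbTE (mx w)) orbF => /eqP->.
by rewrite mem_head.
Qed.

(** A new element comparable with the whole longer chain would either extend the chain below [x] or
    lie strictly between [x] and [y]. Comparing the sums of the two chains yields [rho_covers]. *)
Lemma max_chain_rcons x y s : covers x y -> max_chain x (rcons s x) ->
  max_chain y (rcons (rcons s x) y).
Proof.
case/andP=> ltxy /forallP nbt [S A M]; split.
- by rewrite -cats1 cat_rcons sorted_cat_cons S /= ltxy.
- rewrite all_rcons lexx /=; apply: sub_all A => w wx; exact: le_trans wx (ltW ltxy).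
move=> w wy; rewrite mem_rcons inE negb_or => /andP[ne nin].
rewrite all_rcons negb_and; apply/orP; right; apply/negP=> all_w.
have ltwy : (w < y)%O by rewrite lt_neqAle ne.
have : (w >=< x)%O by apply: (allP all_w); rewrite mem_rcons mem_head.
case/orP=> [wx | xw]; first by have := M w wx nin; rewrite all_w.
have := nbt w; rewrite ltwy andbT lt_neqAle xw andbT negbK => /eqP E.
by rewrite -E mem_rcons mem_head in nin.
Qed.

Lemma max_chain_exists x : exists s, max_chain x (rcons s x).
Proof.
have [n] := ubnP #|[set y | (y < x)%O]|; elim: n x => // n IH x.
case: (pickP (fun y => (y < x)%O)) => [y yx | none] len; last first.
  by exists [::]; apply: max_chain_min => y; rewrite none.
have [z _ czx] := covers_below yx; have zx : (z < x)%O by case/andP: czx.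
have [|s Hs] := IH z; last by exists (rcons s z); apply: max_chain_rcons.
rewrite -ltnS (leq_trans _ len) // ltnS; apply: proper_card.
apply/properP; split; last by exists z; rewrite inE ?ltxx.
by apply/subsetP=> w; rewrite !inE => wz; exact: lt_trans wz zx.
Qed.

Lemma chain_sum_rcons omega s x y :
  chain_sum omega (rcons (rcons s x) y) = (chain_sum omega (rcons s x) + eps omega x y)%R.
Proof.
rewrite /chain_sum.
elim: s => [|a s IH]; first by rewrite /= big_seq1 big_nil add0r.
case: s IH => [_ | b s IH]; first by rewrite /= !big_cons !big_nil !addr0.
have zipE u : zip [:: a, b & u] (behead [:: a, b & u]) = (a, b) :: zip (b :: u) (behead (b :: u)).
  by [].
by rewrite !rcons_cons !zipE !big_cons -!rcons_cons IH addrA.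
Qed.

Section Rank.
Variables (omega : T -> nat) (rho : T -> int).
Hypothesis consistent : forall z s, max_chain z s -> chain_sum omega s = rho z.

Lemma rho_min x : (forall y, ~~ (y < x)%O) -> rho x = 0%R.
Proof. by move/max_chain_min/consistent<-; rewrite /chain_sum /= big_nil. Qed.

Lemma rho_covers x y : covers x y -> rho y = (rho x + eps omega x y)%R.
Proof.
move=> cxy; have [s Hs] := max_chain_exists x.
by rewrite -(consistent (max_chain_rcons cxy Hs)) chain_sum_rcons (consistent Hs).
Qed.
End Rank.

(** * Linear extensions as words *)

Lemma lin_extE (s : #|T|.-tuple T) :
  lin_ext s = (tval s \in words [set: T]) && linear_word (tval s).
Proof.
apply/andP/andP => -[].
- move=> Us /forallP lin.
  have sT : tval s \in words [set: T].
    apply/wordsP; split=> // x; rewrite inE.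
    have [|_ ->] := uniq_min_size (s2 := enum T) Us (fun y _ => mem_enum T y).
      by rewrite -cardE size_tuple.
    by rewrite mem_enum.
  split=> //; case: (tval s) Us lin sT => // x0 s' Us lin sT.
  apply/(pairwiseP x0) => i j; rewrite !inE => lti ltj ltij.
  apply/negP=> lt; have := implyP (forallP (lin _) _) lt.
  by rewrite !index_uniq // ltnNge ltnW.
- move=> /wordsP[Us sT] lin; split=> //; apply/forallP=> x; apply/forallP=> y; apply/implyP=> ltxy.
  have xs : x \in tval s by rewrite sT inE.
  have ys : y \in tval s by rewrite sT inE.
  rewrite ltnNge leq_eqVlt negb_or; apply/andP; split.
    by apply: contraTneq ltxy => E; rewrite -(nth_index x ys) E nth_index // ltxx.
  apply/negP=> ji; have := @linear_nth _ _ x s (index y s) (index x s) lin.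
  by rewrite ji index_mem xs !nth_index // ltxy => /(_ isT).
Qed.

Lemma W_words (omega : T -> nat) :
  W omega = (\sum_(w <- words [set: T] | linear_word w) 'X^(des (map omega w)))%R.
Proof.
have E : perm_eq [seq tval s | s <- enum {: #|T|.-tuple T} & lin_ext s]
                 [seq w <- words [set: T] | linear_word w].
  apply: uniq_perm; rewrite ?filter_uniq ?words_uniq //.
    by rewrite (map_inj_uniq val_inj) filter_uniq // enum_uniq.
  move=> w; rewrite mem_filter andbC; apply/mapP/idP.
    by case=> s; rewrite mem_filter lin_extE => /andP[+ _] ->.
  move=> H; have sz : size w == #|T| by case/andP: H => /size_words->; rewrite cardsT.
  by exists (Tuple sz); rewrite // mem_filter lin_extE H mem_enum.
by rewrite /W -[RHS]big_filter -(perm_big _ E) /= big_map big_filter big_enum_cond.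
Qed.
End Poset.

(** * Canonical relabelling *)

Section Relabelling.
Variables (d : Order.disp_t) (T : finPOrderType d).

(** The hypotheses of the counting argument, bundled because they are met by two pairs: [omega] with
    0, and [canon_label] with [half_rank]. *)
Definition admissible (k : T -> nat) (c : T -> int) :=
  [/\ injective k,
      forall x : T, (forall y : T, ~~ (y < x)%O) -> c x = 0%R &
      forall z, compatible k z -> (forall x, 0 <= z x)%R ->
        forall l, maximal l -> (forall x, x != l -> before k z x l) ->
        forall x, (0 <= z x - c x <= z l - c l)%R].

(** Both pairs describe the same set of maps into [{0, ..., n}]. Counting it by sorting words in
    both ways, for every [n], gives equal binomial sums, from which [binomial_sum_inj] recovers the
    distribution. *)
Lemma dstat_equidistributed (x0 : T) (k1 k2 : T -> nat) (c1 c2 : T -> int) :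
  admissible k1 c1 -> admissible k2 c2 ->
  (forall sg : T -> int, compatible k1 (fun x => sg x + c1 x)%R <->
                         compatible k2 (fun x => sg x + c2 x)%R) ->
  forall a : nat,
    count (fun s => dstat k1 c1 s == a) [seq w <- words [set: T] | linear_word w] =
    count (fun s => dstat k2 c2 s == a) [seq w <- words [set: T] | linear_word w].
Proof.
move=> [inj1 min1 bnd1] [inj2 min2 bnd2] eq12 a.
set r := filter _ _.
have mem_r s : s \in r -> s \in words [set: T] /\ linear_word s.
  by rewrite mem_filter => /andP[].
have ge0 s : s \in r -> (0 <= dstat k1 c1 s)%R && (0 <= dstat k2 c2 s)%R.
  by case/mem_r=> sw lin; rewrite (dstat_ge0 inj1 min1 bnd1) ?(dstat_ge0 inj2 min2 bnd2).
have H n : \sum_(s <- r) (if `|dstat k1 c1 s|%N <= n then 'C(#|T| + (n - `|dstat k1 c1 s|%N), #|T|) else 0) =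
           \sum_(s <- r) (if `|dstat k2 c2 s|%N <= n then 'C(#|T| + (n - `|dstat k2 c2 s|%N), #|T|) else 0).
  pose F := [set sg : {ffun T -> 'I_n.+1} | [forall x, forall y, (x < y)%O ==>
              before k1 (fun x => (sg x)%:Z + c1 x)%R x y]].
  have F1 (sg : {ffun T -> 'I_n.+1}) : reflect (compatible k1 (fun x => (sg x)%:Z + c1 x)%R) (sg \in F).
    rewrite inE; apply: (iffP forallP) => H x; last first.
      by apply/forallP=> y; apply/implyP; apply: H.
    by move=> y; apply: implyP; apply: (forallP (H x)).
  have F2 (sg : {ffun T -> 'I_n.+1}) : reflect (compatible k2 (fun x => (sg x)%:Z + c2 x)%R) (sg \in F).
    by apply: (iffP (F1 sg)) => H; apply/(eq12 (fun x => (sg x)%:Z)%R).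
  clearbody F.
  have E := etrans (esym (card_F_sum inj1 F1)) (card_F_sum inj2 F2).
  rewrite -big_filter -/r -[RHS]big_filter -/r in E.
  transitivity (\sum_(s <- r)
      #|[set sg in F | sorted (before k1 (fun x => (sg x)%:Z + c1 x)%R) s]|).
    rewrite big_seq [RHS]big_seq; apply: eq_bigr => s sr; have [sw lin] := mem_r s sr.
    rewrite (card_fiber inj1 min1 bnd1 F1 x0 sw lin); have := ge0 s sr.
    case: (dstat k1 c1 s) => [m|m] //= _; rewrite lez_nat; case: ifP => // le_mn.
    by congr 'C(_ + _, _); lia.
  rewrite E big_seq [RHS]big_seq; apply: eq_bigr => s sr; have [sw lin] := mem_r s sr.
  rewrite (card_fiber inj2 min2 bnd2 F2 x0 sw lin); have := ge0 s sr.
  case: (dstat k2 c2 s) => [m|m] //=; rewrite ?andbF //= => _.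
  rewrite lez_nat; case: ifP => // le_mn.
  by congr 'C(_ + _, _); lia.
have := binomial_sum_inj H a.
rewrite -!sum1_count big_seq_cond [RHS]big_seq_cond => E.
rewrite big_seq_cond [RHS]big_seq_cond.
transitivity (\sum_(i <- r | (i \in r) && (`|dstat k1 c1 i|%N == a)) 1).
  by apply: eq_bigl => s; case: (boolP (s \in r)) => //= /ge0; lia.
by rewrite E; apply: eq_bigl => s; case: (boolP (s \in r)) => //= /ge0; lia.
Qed.

Lemma icoef_sumXn (S : Type) (r : seq S) (P : pred S) (f : S -> nat) i :
  (icoef (\sum_(s <- r | P s) 'X^(f s))%R i = (count (fun s => P s && ((f s)%:Z == i)) r)%:Z)%R.
Proof.
have icoef0 : icoef 0%R i = 0%R by case: i => n //=; rewrite coef0.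
elim: r => [|s r IH]; first by rewrite big_nil.
rewrite big_cons /=; case: (P s) => //=; rewrite icoefD IH.
suff -> : icoef 'X^(f s)%R i = Posz (Posz (f s) == i) by [].
case: i {IH icoef0} => n; rewrite /icoef ?coefXn; last by case: eqP.
by rewrite eqz_nat eq_sym; case: eqP.
Qed.

(** * The labelling by parity of the rank *)

Variables (omega : T -> nat) (rho : T -> int).
Hypothesis omega_inj : injective omega.
Hypothesis omega_le : forall x, omega x <= #|T|.
Hypothesis consistent : forall z s, max_chain z s -> chain_sum omega s = rho z.
Hypothesis max_close : forall x y : T, maximal x -> maximal y -> (`|rho x - rho y| <= 1)%R.

Definition odd_rank x := (rho x %% 2)%Z == 1%R.
Definition half_rank x := (rho x %/ 2)%Z.
(** The shift exceeds every value of [omega], so the odd elements come last and each parity class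
    keeps its [omega] order. *)
Definition canon_label x := omega x + odd_rank x * #|T|.+1.

Lemma rhoE x : rho x = (half_rank x *+ 2 + (odd_rank x)%:Z)%R.
Proof. rewrite /half_rank /odd_rank; lia. Qed.

Lemma canon_inj : injective canon_label.
Proof.
move=> x y; rewrite /canon_label => E; apply: omega_inj.
have := omega_le x; have := omega_le y.
by case: (odd_rank x) E; case: (odd_rank y); lia.
Qed.

Lemma canon_par x y : ~~ odd_rank x -> odd_rank y -> canon_label x < canon_label y.
Proof. by rewrite /canon_label => /negbTE-> ->; have := omega_le x; lia. Qed.

Lemma par_covers x y : covers x y -> odd_rank y = ~~ odd_rank x.
Proof. by move/(rho_covers consistent); rewrite /odd_rank /eps; case: ifP => _ ->; lia. Qed.

Lemma par_between x y : (x < y)%O -> odd_rank x = odd_rank y ->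
  exists z, [/\ (x < z)%O, (z < y)%O & odd_rank z != odd_rank x].
Proof.
move=> ltxy Exy; have [z le_xz czy] := covers_below ltxy.
have pz := par_covers czy; exists z; split.
- rewrite lt_neqAle le_xz andbT; apply/eqP=> E; move: pz; rewrite -E Exy.
  by case: (odd_rank y).
- by case/andP: czy.
- by rewrite Exy pz; case: (odd_rank z).
Qed.

Lemma compatible_covers k z :
  (forall x y : T, covers x y -> before k z x y) -> compatible k z.
Proof. by move=> H; apply: covers_ind => //; apply: before_trans. Qed.

(** Where the two labellings order a cover oppositely, [half_rank] changes by 1, which exchanges
    weak and strict inequality; where they agree, it is constant. *)
Lemma before_canon (sg : T -> int) x y : covers x y ->
  before omega (fun x => sg x + 0)%R x y = before canon_label (fun x => sg x + half_rank x)%R x y.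
Proof.
move=> cxy; have := rho_covers consistent cxy; have := par_covers cxy.
rewrite /before /canon_label !rhoE /eps.
have : omega x != omega y.
  by rewrite (inj_eq omega_inj) lt_eqF //; case/andP: cxy.
have := omega_le x; have := omega_le y.
by case: (odd_rank x) => /= ? ? ? ->; case: ltnP; lia.
Qed.

Lemma compatible_canon (sg : T -> int) :
  compatible omega (fun x => sg x + 0)%R <-> compatible canon_label (fun x => sg x + half_rank x)%R.
Proof.
split=> H; apply: compatible_covers => x y cxy; have /andP[ltxy _] := cxy.
  by rewrite -before_canon // H.
by rewrite before_canon // H.
Qed.

Lemma admissible_omega : admissible omega (fun=> 0%R).
Proof.
split=> // z _ z0 l _ zl x; rewrite !subr0 z0 /=.
by case: (eqVneq x l) => [->|/zl/before_le].
Qed.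

Lemma admissible_canon : admissible canon_label half_rank.
Proof.
split; first exact: canon_inj.
  by move=> x /(rho_min consistent); rewrite /half_rank => ->.
move=> z cz z0 l maxl zl.
have mono x y : (x <= y)%O -> (z x - half_rank x <= z y - half_rank y)%R.
  rewrite le_eqVlt => /orP[/eqP->//|].
  move: x y; apply: (covers_ind (r := fun x y => (z x - half_rank x <= z y - half_rank y)%R)).
    by move=> y x t; apply: le_trans.
  move=> x y cxy; have /andP[/cz b _] := cxy.
  move: b; have := rho_covers consistent cxy; have := par_covers cxy.
  rewrite !rhoE /before /canon_label /eps; have := omega_le x; have := omega_le y.
  by case: (odd_rank x) => /= ? ? ->; case: ltnP; lia.
move=> x; apply/andP; split.
  have [m le_mx min_m] := minimal_below x; apply: le_trans (mono _ _ le_mx).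
  have -> : half_rank m = 0%R by rewrite /half_rank (rho_min consistent min_m).
  by rewrite subr0 z0.
(* The closeness of maximal ranks enters here: [half_rank m] is below [half_rank l] only if [m] is
   odd and [l] even, by one, and then the labels force [z m < z l]. *)
have [m le_xm max_m] := maximal_above x; apply: le_trans (mono _ _ le_xm) _.
case: (eqVneq m l) => [->//|/zl].
have := max_close max_m maxl; rewrite !rhoE /before /canon_label.
by have := omega_le m; have := omega_le l; case: (odd_rank m); case: (odd_rank l) => /=; lia.
Qed.
End Relabelling.

(** * Unimodality of the descent polynomial *)

Lemma linear_word_ends (d : Order.disp_t) (T : finPOrderType d) (c : T -> int) (x0 : T) s :
  (forall x : T, (forall y : T, ~~ (y < x)%O) -> c x = 0%R) ->
  s \in words [set: T] -> linear_word s ->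
  c (nth x0 s 0) = 0%R /\ maximal (last x0 s).
Proof.
move=> c_min sw lin; have /wordsP[Us _] := sw.
(* The position in [s] serves as a map sorted by [s]. *)
have S : sorted (before (fun=> 0) (fun x => (index x s)%:Z)%R) s.
  apply/(sortedP x0) => i lti; rewrite /before !index_uniq ?(ltnW lti) //.
  by rewrite ltz_nat ltnSn.
by have [] := ends_bounds c_min x0 sw lin S.
Qed.

Theorem theorem4p5 (d : Order.disp_t) (T : finPOrderType d) (omega : T -> nat)
  (omega_inj : injective omega)
  (omega_range : forall x : T, 1 <= omega x <= #|T|)
  (rho : T -> int)
  (consistent : forall (z : T) (s : seq T), max_chain z s -> chain_sum omega s = rho z)
  (max_close : forall x y : T, maximal x -> maximal y -> (`|rho x - rho y| <= 1)%R) :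
  unimodal (W omega).
Proof.
case: (pickP (predT : pred T)) => [x0 _ | T0]; last first.
  have E : [set: T] = set0 by apply/setP=> x; have := T0 x.
  apply: (@unimodal_symuni2 _ (icoef (W omega)) (icoef 0) 0 0) => //.
  - apply: gam_symuni; apply: (gam_eq gam1) => //.
    by rewrite W_words E words0 big_cons big_nil /= addr0.
  - by apply: gam_symuni; apply: gam0.
  - by move=> i; rewrite /= coef0 addr0.
have [xm _ max_xm] := maximal_above x0.
have omega_le x : omega x <= #|T| by case/andP: (omega_range x).
pose k := canon_label omega rho.
(* [half_rank] is constant on the maximal elements of a given parity; the default
   keeps [cl_close] true when one parity does not occur. *)
pose cl (l : bool) := if [pick x | maximal x && (odd_rank rho x == l)] is Some x
  then half_rank rho x else half_rank rho xm.
have clE x : maximal x -> cl (odd_rank rho x) = half_rank rho x.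
  move=> mx; rewrite /cl; case: pickP => [y /andP[my /eqP] | /(_ x)].
    by have := max_close _ _ mx my; rewrite !(rhoE rho); case: (odd_rank rho x); case: (odd_rank rho y) => //=; lia.
  by rewrite mx eqxx.
(* The quantity is the difference of the doubled centres [#|T| - 1 - l - 2 cl l] for [l = false] and
   [l = true]. *)
have cl_close : (`|(cl true - cl false) *+ 2 + 1| <= 1)%R.
  rewrite /cl; case: pickP => [x /andP[mx /eqP px] | n1]; case: pickP => [y /andP[my /eqP py] | n0].
  - by have := max_close _ _ mx my; rewrite !(rhoE rho) px py; lia.
  - have := max_close _ _ mx max_xm; have := n0 xm; rewrite max_xm !(rhoE rho) px.
    by case: (odd_rank rho xm) => //= _; lia.
  - have := max_close _ _ my max_xm; have := n1 xm; rewrite max_xm !(rhoE rho) py.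
    by case: (odd_rank rho xm) => //= _; lia.
  - by lia.
(* The first letter is minimal, hence of rank 0 and even; only the last parity varies. *)
pose Q (l : bool) w := [&& linear_word w, starts (odd_rank rho) false w & ends (odd_rank rho) l w].
pose V (l : bool) : {poly int} := (\sum_(w <- words [set: T] | Q l w) 'X^(des (map k w)))%R.
have gamV (l : bool) : gam (#|[set: T]|%:Z - 1 + (false%:Z - l%:Z))%R (V l).
  apply: (@linear_gam _ _ (odd_rank rho) k _ _ _ #|T|); last by rewrite cardsT.
  - exact: canon_inj.
  - by move=> x y; apply: canon_par.
  - by move=> x y; apply: par_between consistent _ _.
  - by move=> x y _ _; rewrite inE.
(* The shift accounts for the term [half_rank] of the last letter in [dstat]: this letter is
   maximal, so [clE] gives the value [cl l]. *)
have sV (l : bool) := symuni_shift (cl l) (gam_symuni (gamV l)).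
apply: (unimodal_symuni2 _ (sV false) (sV true)); first lia.
move=> i; rewrite /V !icoef_sumXn -PoszD.
have -> : ((W omega)`_i)%R = icoef (W omega) i by [].
rewrite W_words icoef_sumXn; congr Posz.
transitivity (count (fun w => dstat omega (fun=> 0%R) w == i) [seq w <- words [set: T] | linear_word w]).
  rewrite count_filter; apply: eq_in_count => w ww /=; rewrite andbC.
  by rewrite (dstatE omega _ x0 ww) subr0.
rewrite (dstat_equidistributed x0 (admissible_omega omega_inj)
  (admissible_canon omega_inj omega_le consistent max_close)); last first.
  by move=> sg; apply: compatible_canon.
(* The two classes are merged into one count; their intersection is empty because a word has one
   last parity. *)
rewrite count_filter -count_predUI.
rewrite [X in _ + X](_ : _ = 0) ?addn0.
  apply: eq_in_count => w ww /=; rewrite /Q.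
  case: (boolP (linear_word w)) => [lin | _]; last by rewrite andbF.
  have [r0 ml] := linear_word_ends x0 (rho_min consistent) ww lin.
  rewrite (dstatE k _ x0 ww) -(clE _ ml) andbT.
  case: w ww {lin} r0 ml => [/wordsP[_ /(_ x0)]|x w _ r0 ml]; first by rewrite !inE.
  have -> : starts (odd_rank rho) false (x :: w) by rewrite /= /odd_rank /= r0.
  rewrite /=; case: (odd_rank rho (last x w)) => /=; rewrite ?orbF; lia.
apply/eqP; rewrite -leqn0 -ltnS ltnNge -has_count; apply/hasPn=> w _ /=; rewrite /Q.
by case: w => [|x w]; rewrite ?andbF //=; case: (odd_rank rho (last x w)); rewrite ?andbF.
Qed.
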